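(* Let $d\in\mathbb N$, let $\Lambda\subset\mathbb R^d$ be $\sigma$-compact and let $\{T_{n,\lambda}: n\in\mathbb N,\lambda\in\Lambda\}$ be a continuous family of operators acting on an $F$-space $X$. Assume that there are a dense set $\mathcal D\subset X$, maps $S_{n,\lambda}:\mathcal D\to\mathcal D$ ($n\in\mathbb N$, $\lambda\in\Lambda$) with $T_{n,\lambda}\circ S_{n,\lambda}=\mathrm{Id}$ on $\mathcal D$, and $D>0$ such that, for all $u\in\mathcal D$ and all compact $K\subset\Lambda$, the following two properties hold. (1) There exist $\kappa\in\mathbb N$ and a summable sequence of positive numbers $(c_k)_k$ such that, for all $n,k\in\mathbb N_0$ with $k\ge\kappa$ and all $\lambda,\mu\in K$ satisfying $\|\lambda-\mu\|\le D\frac{k^{1/d}}{(n+k)^{1/d}}$, we have $$\|T_{n+k,\lambda}S_{n,\mu}u\|\le c_k\quad\text{and}\quad \|T_{n,\lambda}S_{n+k,\mu}u\|\le c_k.$$ (2) For every $\eta>0$ there is $\tau>0$ such that, for all $n\in\mathbb N$ and all $\lambda,\mu\in K$, $$\|\lambda-\mu\|\le\frac{\tau}{n^{1/d}}\implies \|T_{n,\lambda}S_{n,\mu}u-u\|<\eta.$$ Then the set of common universal vectors for the family $\{T_{n,\lambda}: n\in\mathbb N,\lambda\in\Lambda\}$ is a dense $G_\delta$ subset of $X$.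
   Context: $\mathbb N=\{1,2,\dots\}$ and $\mathbb N_0=\mathbb N\cup\{0\}$. $\mathbb R^d$ carries the maximum norm $\|\lambda-\mu\|=\max_{j}|\lambda(j)-\mu(j)|$. An $F$-space is a topological vector space whose topology is induced by a complete translation-invariant metric $\delta$; for $x\in X$, $\|x\|:=\delta(x,0)$ is the associated $F$-norm. An operator is a continuous linear map $X\to X$. The family $\{T_{n,\lambda}\}$ is continuous if, for each $n\in\mathbb N$, the map $(\lambda,u)\mapsto T_{n,\lambda}u$ from $\Lambda\times X$ to $X$ is continuous for the product topology. By convention $T_{0,\lambda}=\mathrm{Id}$ on $X$ and $S_{0,\lambda}=\mathrm{Id}$ on $\mathcal D$ for all $\lambda$. A vector $u\in X$ is a common universal vector for $\{T_{n,\lambda}: n\in\mathbb N,\lambda\in\Lambda\}$ if, for every $\lambda\in\Lambda$, the set $\{T_{n,\lambda}u: n\in\mathbb N\}$ is dense in $X$.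
   Formalization: The F-space X is additionally assumed separable; without this the claim fails (e.g. powers of twice the backward shift on ℓ²(ℕ,H) with H non-separable), and for nonempty Λ the conclusion forces separability. *)

(* Defs.v *)
From mathcomp Require Import all_boot all_order all_algebra.
From mathcomp Require Import complex.
From mathcomp Require Import boolp classical_sets functions cardinality reals.
From mathcomp Require Import topology normedtype sequences exp borel_hierarchy.

Set Implicit Arguments.
Unset Strict Implicit.
Unset Printing Implicit Defensive.

Import Order.TTheory GRing.Theory Num.Theory.
Import numFieldNormedType.Exports.

Local Open Scope classical_set_scope.
Local Open Scope ring_scope.

(* The scalar field of a topological vector space is R or R[i]; in either case
   the F-norm takes its values in R. *)
Variant real_or_complex (R : realType) : numFieldType -> Prop :=
| RealScalars : @real_or_complex R R
| ComplexScalars : @real_or_complex R (R[i]).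

(* No local convexity is required, so X is not a tvsType. *)
Record fspace_metric (R : realType) (K : numFieldType)
    (X : topologicalLmodType K) (delta : X -> X -> R) : Prop := FSpaceMetric {
  fspace_metric_eq0 : forall x y, delta x y = 0 <-> x = y;
  fspace_metric_sym : forall x y, delta x y = delta y x;
  fspace_metric_triangle : forall x y z,
    delta x z <= delta x y + delta y z;
  fspace_metric_translation : forall x y z,
    delta (x + z) (y + z) = delta x y;
  fspace_metric_nbhs : forall x : X,
    nbhs x = filter_from [set e : R | 0 < e]
               (fun e => [set y | delta x y < e]);
  fspace_metric_complete : forall u : X^nat,
    (forall e : R, 0 < e -> exists N : nat, forall m n : nat,
      (N <= m)%N -> (N <= n)%N -> delta (u m) (u n) < e) ->
    exists l : X, u @ \oo --> l
}.

Definition fnorm (R : realType) (K : numFieldType) (X : topologicalLmodType K)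
  (delta : X -> X -> R) (x : X) : R := delta x 0.

Definition separable (T : topologicalType) : Prop :=
  exists2 A : set T, countable A & dense A.

Definition sigma_compact (T : topologicalType) (A : set T) : Prop :=
  exists2 F : (set T)^nat, (forall i, compact (F i)) & A = \bigcup_i F i.

Section families.
Context (R : realType) (K : numFieldType)
  (X : topologicalLmodType K) (d : nat).
Implicit Types (Lambda : set 'rV[R]_d) (T : nat -> 'rV[R]_d -> {linear X -> X}).

(* T n lambda is meaningful only for lambda in Lambda; the indices of the
   family start at 1, and index 0 is reserved for the identity. *)
Definition continuous_operator_family Lambda T : Prop :=
  forall n, (0 < n)%N ->
    (forall lambda, Lambda lambda -> continuous (T n lambda)) /\
    {within Lambda `*` [set: X],
      continuous (fun p : 'rV[R]_d * X => T n p.1 p.2)}.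

Definition common_universal Lambda T : set X :=
  [set u | forall lambda, Lambda lambda ->
    dense [set T n lambda u | n in [set n | (0 < n)%N]]].

End families.

(* Main.v *)
(* By Baire's theorem it suffices, for Q in a countable cover of Lambda by
   small compact sets and u, v in calD, to find w close to u such that every
   lambda in Q has an n with T n lambda w close to v.  We take
   w = u + \sum_t S (M t) (lambda_t) v for a large integer M, where t runs over
   finitely many active times and lambda_t is a point of Q.  The hypotheses give
   the estimates as soon as
   - each lambda in Q satisfies |lambda - lambda_t|^d t <= theta for some t;
   - |lambda_t - lambda_t'|^d t' <= kap (t' - t) whenever t < t',
   where kap depends only on D and d while theta is arbitrarily small.
   Such times are found by recursive halving.  From time m on, a ball of diameter
   s is served by the single time m if s^d m <= theta; otherwise its 2^d halves
   are served one after the other, separated by pauses of relative length about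
   s^d / kap.  In logarithmic time, a recursion of depth l then costs at most
   s^d (b + B l), with B independent of theta.  As halving l times multiplies the
   latest time allowed by 2^(d l), the recursion fits in as soon as B s^d <= 1/4,
   a bound on s depending only on D and d. *)

Require Import Defs.
From mathcomp Require Import all_boot all_order all_algebra.
From mathcomp Require Import boolp classical_sets functions cardinality reals.
From mathcomp Require Import topology normedtype sequences exp borel_hierarchy.
From mathcomp Require Import zify ring lra.

Set Implicit Arguments.
Unset Strict Implicit.
Unset Printing Implicit Defensive.

Import Order.TTheory GRing.Theory Num.Theory.
Import numFieldNormedType.Exports.

Local Open Scope classical_set_scope.
Local Open Scope ring_scope.

(** * Schedules: pauses and concatenation *)

(* The last time before the pause is e - 1; the first time after it is m. *)
Lemma gap_exists (R : realType) (e : nat) (y : R) :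
  (0 < e)%N -> 0 <= y -> y <= 2^-1 ->
  exists2 m : nat, (e <= m)%N & y * m%:R <= m%:R - e%:R + 1 /\
    m%:R <= e%:R * (1 + 2 * y).
Proof.
(* [x] solves y * x = x - e + 1, and the witness is the next integer above it. The upper bound uses
   1 / (1 - y) <= 1 + 2 * y, valid for y <= 1/2. *)
move=> e0 y0 y2; set x := (e%:R - 1) / (1 - y).
have e1 : 1 <= e%:R :> R by rewrite ler1n.
have y1 : 0 < 1 - y by lra.
have x0 : 0 <= x by apply: divr_ge0; lra.
have xE : x * (1 - y) = e%:R - 1 by rewrite divfK// gt_eqF.
have /andP[xl xr] := truncn_itv x0.
exists (Num.truncn x).+1; last first.
  have xy : x * 1 <= x * ((1 - y) * (1 + 2 * y)) by rewrite ler_wpM2l//; nra.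
  rewrite mulrA xE mulr1 in xy.
  have xy' : x * (1 - y) <= (Num.truncn x).+1%:R * (1 - y).
    by rewrite ler_pM2r// ltW.
  by rewrite -natr1 in xy' *; split; lra.
rewrite -ltnS -(ltr_nat R).
have : e%:R - 1 < (Num.truncn x).+1%:R :> R by apply: le_lt_trans xr; nra.
by rewrite ltrBlDr natr1.
Qed.

(* act holds the active times, all in [m, e), and pt t is the parameter served
   at time t; pt is junk at inactive times. *)
Definition schedule (R : realType) (V : normedModType R) (d : nat)
    (theta kap : R) (A : set V) (m e : nat) : Prop :=
  exists (act : pred nat) (pt : nat -> V),
  [/\ forall t, act t -> (m <= t < e)%N /\ A (pt t),
      forall x, A x -> exists2 t, act t & `|x - pt t| ^+ d * t%:R <= theta &
      forall t t', act t -> act t' -> (t < t')%N ->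
        `|pt t - pt t'| ^+ d * t'%:R <= kap * (t' - t)%:R].

Section schedules.
Context (R : realType) (V : normedModType R) (d : nat) (theta kap : R).
Hypothesis kap_gt0 : 0 < kap.
Local Notation schedule := (@schedule R V d theta kap).

Lemma schedule_set0 m e : schedule set0 m e.
Proof. by exists pred0, (fun=> 0); split. Qed.

Lemma schedule_single (A : set V) m :
  (forall x y, A x -> A y -> `|x - y| ^+ d * m%:R <= theta) ->
  schedule A m m.+1.
Proof.
move=> Ath; have [->|/set0P[a Aa]] := eqVneq A set0; first exact: schedule_set0.
exists (pred1 m), (fun=> a); split.
- by move=> t /eqP ->; rewrite leqnn ltnSn.
- by move=> x Ax; exists m; rewrite /= ?eqxx//; exact: Ath.
- by move=> t t' /eqP -> /eqP ->; rewrite ltnn.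
Qed.

(** Only pairs t < e <= m' <= t' are new. There t' - t >= t' - e + 1, and the inequality assumed at
    m' persists at t' because y <= 1. *)
Lemma schedule_cat (A B : set V) m e m' e' y :
  (m <= e)%N -> (e <= m')%N -> (m' <= e')%N -> 0 <= y -> y <= 1 ->
  y * m'%:R <= m'%:R - e%:R + 1 ->
  (forall a b, A a -> B b -> `|a - b| ^+ d <= kap * y) ->
  schedule A m e -> schedule B m' e' -> schedule (A `|` B) m e'.
Proof.
move=> me em' m'e' y0 y1 ym' AB [a1 [p1 [r1 c1 s1]]] [a2 [p2 [r2 c2 s2]]].
pose act t := if (t < e)%N then a1 t else a2 t.
pose pt t := if (t < e)%N then p1 t else p2 t.
have lo t : a1 t -> (t < e)%N by move=> /r1[/andP[]].
have hi t : a2 t -> (t < e)%N = false.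
  by move=> /r2[/andP[+ _] _] => m't; apply/negbTE; rewrite -leqNgt; lia.
exists act, pt; split.
- rewrite /act /pt => t; case: ifP => te at_.
    by have [? ?] := r1 _ at_; split; [lia|left].
  by have [? ?] := r2 _ at_; split; [lia|right].
- move=> x [/c1|/c2] [t at_ tx]; exists t.
  + by rewrite /act lo.
  + by rewrite /pt lo.
  + by rewrite /act hi.
  + by rewrite /pt hi.
- rewrite /act /pt => t t'; case: ifP => te at_; case: ifP => te' at' tt'.
  + exact: s1.
  + have [/andP[m't' _] Bt'] := r2 _ at'; have [_ At] := r1 _ at_.
    apply: (@le_trans _ _ (kap * y * t'%:R)).
      by rewrite ler_wpM2r// AB.
    rewrite -mulrA ler_pM2l// natrB 1?ltnW//.
    have : m'%:R <= t'%:R :> R by rewrite ler_nat.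
    have : t%:R + 1 <= e%:R :> R by rewrite natr1 ler_nat.
    nra.
  + by move: te te'; lia.
  + exact: s2.
Qed.

(** Serving one set multiplies the time by at most [expR a], and the pause after it by 1 + 2 * y <=
    [expR (2 * y)]. [M] is a deadline: each set need be schedulable only from times that let it
    finish by [M]. *)
Lemma schedule_seq (s : seq (set V)) (M a y : R) (m : nat) :
  (0 < m)%N -> 0 <= a -> 0 <= y -> y <= 2^-1 ->
  (forall A B, A \in s -> B \in s -> forall x x', A x -> B x' ->
     `|x - x'| ^+ d <= kap * y) ->
  (forall A n, A \in s -> (m <= n)%N -> n%:R * expR a <= M ->
     exists2 e, (n <= e)%N & schedule A n e /\ e%:R <= n%:R * expR a) ->
  m%:R * expR (a + 2 * y) ^+ size s <= M ->
  exists2 e, (m <= e)%N & schedule [set x | exists2 A, A \in s & A x] m e /\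
    e%:R <= m%:R * expR (a + 2 * y) ^+ size s.
Proof.
have expR_ge1 (x : R) : 0 <= x -> 1 <= expR x.
  by move=> x0; apply: le_trans (expR_ge1Dx x); lra.
move=> m0 a0 y0 y2; elim: s m m0 => [|A s IH] m m0 dist HA mM.
  exists m => //; split; last by rewrite expr0 mulr1.
  rewrite (_ : mkset _ = set0); first exact: schedule_set0.
  by rewrite -subset0 => x [].
have E1 : 1 <= expR (a + 2 * y) by apply: expR_ge1; lra.
have En k : 1 <= expR (a + 2 * y) ^+ k by apply: exprn_ege1.
have aM : m%:R * expR a <= M.
  apply: le_trans mM; rewrite ler_wpM2l//= exprS expRD.
  rewrite -mulrA ler_peMr ?expR_ge0//.
  by rewrite -[leLHS]mulr1 ler_pM//; rewrite ?expR_ge1// -?expRD//; lra.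
have [e me [schA em]] := HA A m (mem_head _ _) (leqnn _) aM.
have [m' em' [ym' m'e]] := @gap_exists _ e y (leq_trans m0 me) y0 y2.
have m'm : m'%:R <= m%:R * expR (a + 2 * y).
  apply: (le_trans m'e); rewrite expRD mulrA ler_pM//; first by lra.
  exact: expR_ge1Dx.
have [||||e' m'e' [schs e'm]] := IH m'.
- exact: leq_trans m0 (leq_trans me em').
- by move=> B C Bs Cs; apply: dist; rewrite inE ?Bs ?Cs orbT.
- move=> B n Bs m'n; apply: HA; first by rewrite inE Bs orbT.
  exact: leq_trans (leq_trans me em') m'n.
- by apply: le_trans mM; rewrite /= exprS mulrA ler_wpM2r// exprn_ge0// expR_ge0.
exists e'; first exact: leq_trans (leq_trans me em') m'e'.
split; last first.
  apply: (le_trans e'm); rewrite /= exprS mulrA ler_wpM2r// exprn_ge0//.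
  exact: expR_ge0.
rewrite (_ : mkset _ = A `|` [set x | exists2 A, A \in s & A x]).
  apply: (@schedule_cat _ _ m e m' e' y) => //; [by lra|].
  move=> x x' Ax [B Bs Bx']; apply: (dist A B) => //; first exact: mem_head.
  by rewrite inE Bs orbT.
apply/seteqP; split=> x.
  move=> [B]; rewrite inE => /orP[/eqP -> Ax|Bs Bx]; first by left.
  by right; exists B.
move=> [Ax|[B Bs Bx]]; first by exists A; rewrite ?mem_head.
by exists B; rewrite // inE Bs orbT.
Qed.

End schedules.

(** * Halving balls of the maximum norm, and schedules for balls *)

Lemma row_norm_le (R : realType) (d : nat) (x : 'rV[R]_d) (r : R) :
  0 <= r -> (`|x| <= r) = [forall i, `|x 0 i| <= r].
Proof.
move=> r0; rewrite [`|x|]mx_normrE; apply/idP/forallP => [xr i|xr].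
  by apply: le_trans xr; exact: (le_bigmax _ _ (ord0, i)).
by apply/bigmax_leP; split => // -[i j] _; rewrite (ord1 i).
Qed.

Lemma row_ball_split (R : realType) (d : nat) (c x : 'rV[R]_d) (h : R) :
  0 <= h -> `|x - c| <= h ->
  exists b : {ffun 'I_d -> bool},
    `|x - (c + \row_i ((-1) ^+ b i * (h / 2)))| <= h / 2.
Proof.
move=> h0; rewrite row_norm_le//.
move=> /forallP xc; exists [ffun i => x 0 i < c 0 i].
rewrite row_norm_le; last by lra.
apply/forallP => i; move: (xc i); rewrite !mxE ffunE.
by case: ltP => xi; rewrite /= ?expr1 ?expr0 !ler_norml => /andP[? ?];
  apply/andP; split; lra.
Qed.

Lemma row_ball_sub (R : realType) (d : nat) (c : 'rV[R]_d) (h : R)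
    (b : {ffun 'I_d -> bool}) (x : 'rV[R]_d) :
  0 <= h -> `|x - (c + \row_i ((-1) ^+ b i * (h / 2)))| <= h / 2 ->
  `|x - c| <= h.
Proof.
move=> h0; rewrite row_norm_le; last by lra.
move=> /forallP xc; rewrite row_norm_le//; apply/forallP => i.
move: (xc i); rewrite !mxE.
by case: (b i); rewrite /= ?expr1 ?expr0 !ler_norml => /andP[? ?];
  apply/andP; split; lra.
Qed.

Section balls.
Context (R : realType) (d : nat) (theta kap : R) (Q : set 'rV[R]_d).
Hypotheses (theta_gt0 : 0 < theta) (kap_gt0 : 0 < kap).
Local Notation schedule := (@schedule R 'rV[R]_d d theta kap).
(** Intersecting with [Q] keeps the served parameters in [Q], where the estimates on [T] and [S]
    hold; a piece may then be empty. *)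
Local Notation dball c h := [set x : 'rV[R]_d | Q x /\ `|x - c| <= h].

Lemma dball_dist (c x y : 'rV[R]_d) (h : R) :
  `|x - c| <= h -> `|y - c| <= h -> `|x - y| ^+ d <= (2 * h) ^+ d.
Proof.
move=> xc yc; have h0 : 0 <= h by apply: le_trans xc.
rewrite lerXn2r ?nnegrE//; first by lra.
by have := ler_distD c x y; rewrite (distrC c y); lra.
Qed.

(* The fuel l counts the halvings after which diameter (2 * h) / 2 ^+ l is served
   by one time before M.  The lower bound on (2 * h) ^+ d * m%:R, inherited from
   the parent ball, makes the duration 1 of a leaf at most
   m%:R * (2 * h) ^+ d * (2 ^+ d / theta). *)
Lemma schedule_ball_step (M : R) (l m : nat) (c : 'rV[R]_d) (h : R) :
  (0 < m)%N -> 0 < h -> (2 * h) ^+ d / kap <= 2^-1 ->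
  theta <= 2 ^+ d * (2 * h) ^+ d * m%:R ->
  (2 * h) ^+ d * M <= theta * (2 ^+ d) ^+ l ->
  m%:R * expR ((2 * h) ^+ d * (2 ^+ d / theta + 2 ^+ d.+1 / kap * l%:R)) <= M ->
  exists2 e, (m <= e)%N & schedule (dball c h) m e /\
    e%:R <= m%:R *
      expR ((2 * h) ^+ d * (2 ^+ d / theta + 2 ^+ d.+1 / kap * l%:R)).
Proof.
elim: l m c h => [|l IH] m c h m0 h0; set z := (2 * h) ^+ d;
  set Ex := (z * (2 ^+ d / theta + _)) => zk th zM mM.
all: have z0 : 0 < z by rewrite exprn_gt0//; lra.
all: have m1 : 1 <= m%:R :> R by rewrite ler1n.
all: have p2 : 0 < 2 ^+ d :> R by rewrite exprn_gt0.
all: have p2' : 0 < 2 ^+ d.+1 :> R by rewrite exprn_gt0.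
all: have Ex0 : z * (2 ^+ d / theta) <= Ex by
  rewrite ler_pM2l// lerDl mulr_ge0// divr_ge0// ltW.
all: have leaf : z * m%:R <= theta -> exists2 e, (m <= e)%N &
    schedule (dball c h) m e /\ e%:R <= m%:R * expR Ex.
1,3: move=> zm; exists m.+1 => //; split; first
    (apply: schedule_single => x y [_ xc] [_ yc];
     apply: le_trans zm; rewrite ler_wpM2r//; exact: dball_dist xc yc).
1,2: rewrite -natr1; apply: le_trans (_ : m%:R * (1 + Ex) <= _);
    last by rewrite ler_wpM2l// expR_ge1Dx.
1,2: rewrite mulrDr mulr1 lerD2l;
    apply: le_trans (_ : m%:R * (z * (2 ^+ d / theta)) <= _);
    last by rewrite ler_wpM2l.
1,2: by rewrite mulrA mulrA ler_pdivlMr// mul1r; lra.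
(* Without fuel the ball is a leaf: m <= M by [mM], and z * M <= theta by [zM]. *)
- apply: leaf; apply: le_trans (_ : z * M <= _); last first.
    by rewrite expr0 mulr1 in zM.
  rewrite ler_pM2l//; apply: le_trans mM; rewrite ler_peMr//.
  apply: le_trans (expR_ge1Dx _); rewrite lerDl; apply: le_trans Ex0.
  by rewrite mulr_ge0// ?divr_ge0// ltW.
- have [/leaf//|zm] := leP (z * m%:R) theta.
  pose sub (b : {ffun 'I_d -> bool}) :=
    dball (c + \row_i ((-1) ^+ b i * (h / 2))) (h / 2).
  pose s := [seq sub b | b <- enum {ffun 'I_d -> bool}].
  have ss : size s = (2 ^ d)%N.
    by rewrite size_map -cardE card_ffun card_bool card_ord.
  have zE : (2 * (h / 2)) ^+ d = z / 2 ^+ d.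
    by rewrite -expr_div_n; congr (_ ^+ _); lra.
  pose a := (z / 2 ^+ d) * (2 ^+ d / theta + 2 ^+ d.+1 / kap * l%:R).
  pose y := z / kap.
  have y0 : 0 <= y by rewrite divr_ge0// ltW.
  have a0 : 0 <= a.
    rewrite /a; apply: mulr_ge0; first by rewrite divr_ge0// ltW.
    apply: addr_ge0; [|apply: mulr_ge0 => //]; by rewrite divr_ge0// ltW.
  (* The 2 ^ d pauses add z * 2 ^ d.+1 / kap to the exponent, exactly the share of one more unit of
     fuel. *)
  have ExE : expR (a + 2 * y) ^+ size s = expR Ex.
    rewrite ss -expRM_natl natrX; congr expR; rewrite /a /y /Ex -natr1 exprS.
    by field; rewrite !gt_eqF.
  have [|||e me [sch em]] :=
    @schedule_seq R 'rV[R]_d d theta kap kap_gt0 s M a y m m0 a0 y0 zk.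
  + move=> A B /mapP[b _ ->] /mapP[b' _ ->] x x' [_ xb] [_ xb'].
    rewrite /y mulrC divfK ?gt_eqF//.
    have xc := row_ball_sub (ltW h0) xb; have xc' := row_ball_sub (ltW h0) xb'.
    exact: dball_dist xc xc'.
  + move=> A n /mapP[b _ ->] mn nM.
    have mnR : m%:R <= n%:R :> R by rewrite ler_nat.
    rewrite /a -zE in nM *; apply: IH => //.
    * exact: leq_trans mn.
    * by rewrite divr_gt0.
    * rewrite zE; apply: le_trans zk; rewrite ler_pM2r ?invr_gt0//.
      by rewrite ler_pdivrMr// ler_peMr ?exprn_ege1 ?ler1n// ltW.
    * rewrite zE mulrCA mulfV ?gt_eqF// mulr1; apply: le_trans (ltW zm) _.
      by rewrite ler_pM2l.
    * rewrite zE mulrAC ler_pdivrMr//; apply: le_trans zM _.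
      by rewrite exprSr mulrA.
  + by rewrite ExE.
  exists e => //; split; last by rewrite -ExE.
  rewrite (_ : dball c h = [set x | exists2 A, A \in s & A x])//.
  apply/seteqP; split=> x.
    move=> [Qx /(row_ball_split (ltW h0))[b xb]].
    by exists (sub b) => //; apply/mapP; exists b; rewrite ?mem_enum.
  move=> [_ /mapP[b _ ->] [Qx xb]]; split=> //.
  exact: row_ball_sub (ltW h0) xb.
Qed.

(** Each unit of fuel multiplies the deadline by 2 ^ d >= 2 but the cost by at most 4/3, so enough
    fuel absorbs the overhead, however small theta is. *)
Lemma schedule_ball (c : 'rV[R]_d) (h : R) :
  (0 < d)%N -> 0 < h -> 2 ^+ d.+1 / kap * (2 * h) ^+ d <= 4^-1 ->
  exists2 m, (0 < m)%N & exists e, schedule (dball c h) m e.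
Proof.
move=> d0 h0; set B := _ / kap; set z := (2 * h) ^+ d => Bz.
have z0 : 0 < z by rewrite exprn_gt0//; lra.
have B0 : 0 < B by rewrite divr_gt0// exprn_gt0.
have p1 : 1 <= 2 ^+ d :> R by rewrite exprn_ege1//; lra.
have [m mth] : exists m : nat, theta / z < m%:R.
  by exists (Num.bound (theta / z)); rewrite archi_boundP// divr_ge0// ltW.
have m0 : (0 < m)%N.
  by rewrite -(ltr_nat R); apply: lt_trans mth; rewrite divr_gt0.
rewrite ltr_pdivrMr// in mth.
(* After division by theta / z, the cost with fuel L is W * expR (B * z) ^ L and the deadline is 2 ^
   (d * L). It remains to use W <= (3/2) ^ L and 3/2 * 4/3 = 2. *)
pose W := z / theta * (m%:R * expR (z * (2 ^+ d / theta))).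
have [L LW] : exists L : nat, 2 * W < L%:R.
  exists (Num.bound (2 * W)); rewrite archi_boundP//.
  by rewrite !mulr_ge0 ?invr_ge0 ?expR_ge0// ltW.
have E4 : expR (B * z) <= 4 / 3.
  have : 1 + - (B * z) <= expR (- (B * z)) by exact: expR_ge1Dx.
  rewrite expRN -[X in X <= _]invrK lef_pV2 ?posrE ?expR_gt0 ?invr_gt0//;
    last by lra.
  move=> /le_trans; apply; rewrite -[leRHS]invrK lef_pV2 ?posrE//; try lra.
have E32 k : 1 + k%:R / 2 <= (3 / 2) ^+ k :> R.
  elim: k => [|k IH]; first by rewrite expr0; lra.
  by rewrite exprS -natr1; have : 0 <= k%:R :> R by []; nra.
have [||||e me [sch _]] :=
    @schedule_ball_step (theta * (2 ^+ d) ^+ L / z) L m c h m0 h0.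
- rewrite ler_pdivrMr// -/z; apply: le_trans (_ : B * z * kap <= _).
    rewrite /B mulrAC divfK ?gt_eqF// exprS -mulrA.
    have : z <= 2 ^+ d * z by rewrite ler_peMl// ltW.
    by lra.
  by rewrite ler_pM2r//; lra.
- rewrite -/z -mulrA mulrC in mth *.
  have : theta <= 2 ^+ d * (z * m%:R).
    by apply: le_trans (ltW mth) _; rewrite mulrC ler_peMl// mulr_ge0// ltW.
  by [].
- by rewrite -/z mulrC divfK// gt_eqF.
- rewrite -/z -/B ler_pdivlMr//.
  have -> : expR (z * (2 ^+ d / theta + B * L%:R)) =
      expR (z * (2 ^+ d / theta)) * expR (B * z) ^+ L.
    by rewrite mulrDr expRD -expRM_natr; congr (_ * expR _); rewrite mulrCA mulrA.
  have -> : m%:R * (expR (z * (2 ^+ d / theta)) * expR (B * z) ^+ L) * z =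
      theta * (W * expR (B * z) ^+ L).
    by rewrite /W; field; rewrite gt_eqF.
  rewrite ler_pM2l//; apply: le_trans (_ : (3 / 2) ^+ L * (4 / 3) ^+ L <= _).
    apply: ler_pM.
    + by rewrite !mulr_ge0 ?invr_ge0 ?expR_ge0// ltW.
    + by rewrite exprn_ge0// expR_ge0.
    + by apply: le_trans (E32 L); lra.
    + by rewrite lerXn2r// ?nnegrE ?expR_ge0//; lra.
  rewrite -exprMn (_ : 3 / 2 * (4 / 3) = 2); last by field.
  rewrite lerXn2r ?nnegrE ?exprn_ge0//; case: (d) d0 => // d' _.
  by rewrite exprS ler_peMr// exprn_ege1// ler1n.
by exists m => //; exists e.
Qed.

End balls.

(** * F-norms and Baire's theorem *)

Section fspaces.
Context (R : realType) (K : numFieldType) (X : topologicalLmodType K).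
Context (delta : X -> X -> R).
Hypothesis dX : fspace_metric delta.
Local Notation N := (fnorm delta).

Lemma delta_fnorm x y : delta x y = N (x - y).
Proof. by rewrite -(fspace_metric_translation dX x y (- y)) subrr. Qed.

Lemma fnorm0 : N 0 = 0.
Proof. exact/(fspace_metric_eq0 dX). Qed.

Lemma fnormN x : N (- x) = N x.
Proof. by rewrite -[- x]add0r -delta_fnorm (fspace_metric_sym dX). Qed.

Lemma fnormD x y : N (x + y) <= N x + N y.
Proof.
have := fspace_metric_triangle dX x 0 (- y).
by rewrite !delta_fnorm opprK subr0 add0r.
Qed.

Lemma fnorm_ge0 x : 0 <= N x.
Proof.
have := fnormD x (- x); rewrite subrr fnorm0 fnormN.
by rewrite -mulr2n pmulrn_lge0.
Qed.

Lemma fnorm_sum (I : Type) (r : seq I) (P : pred I) (f : I -> X) :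
  N (\sum_(i <- r | P i) f i) <= \sum_(i <- r | P i) N (f i).
Proof.
elim/big_ind2 : _ => [|x a y b xa yb|//]; first by rewrite fnorm0.
by apply: le_trans (fnormD _ _) _; exact: lerD.
Qed.

Lemma fspace_nbhsP (x : X) (A : set X) :
  nbhs x A <-> exists2 e : R, 0 < e & forall y, N (y - x) < e -> A y.
Proof.
rewrite (fspace_metric_nbhs dX); split=> [[e e0 eA]|[e e0 eA]]; exists e => //.
  by move=> y yx; apply: eA; rewrite /= delta_fnorm -fnormN opprB.
by move=> y /=; rewrite delta_fnorm -fnormN opprB => /eA.
Qed.

Lemma dense_nbhs (A : set X) (x : X) (B : set X) :
  dense A -> nbhs x B -> exists2 a, A a & B a.
Proof.
rewrite nbhsE => dA [U [oU Ux] UB].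
by have [a [Ua Aa]] := dA U (ex_intro _ x Ux) oU; exists a => //; exact: UB.
Qed.

(** Nested closed balls: the centres form a Cauchy sequence whose limit lies in every ball, hence in
    every [A n]. *)
Lemma fspace_baire (A : (set X)^nat) :
  (forall i, open (A i)) -> (forall i, dense (A i)) -> dense (\bigcap_i A i).
Proof.
move=> oA dA O [x0 Ox0] oO.
(* A pair is a closed ball, given by centre and radius. The premise 0 < p.2 makes the relation
   total, so that [choice] applies. *)
pose good (n : nat) (p q : X * R) := 0 < p.2 -> [/\ 0 < q.2, q.2 <= p.2 / 2 &
  forall y, N (y - q.1) <= q.2 -> A n y /\ N (y - p.1) <= p.2].
have step n p : exists q, good n p q.
  case: (ltP 0 p.2) => [p0|np]; last by exists p => /lt_geF; rewrite np.
  have [] := @dense_nbhs (A n) p.1 [set y | N (y - p.1) < p.2 / 2] (dA n).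
    by apply/fspace_nbhsP; exists (p.2 / 2) => //; rewrite divr_gt0.
  move=> z Az zp; have /fspace_nbhsP[e e0 eA] : nbhs z (A n).
    by have := oA n; rewrite openE; exact.
  exists (z, Num.min (e / 2) (p.2 / 2)) => _; split => /=.
  - by rewrite lt_min !divr_gt0.
  - by rewrite ge_min lexx orbT.
  - move=> y; rewrite le_min => /andP[ye yp]; split.
      by apply: eA; apply: le_lt_trans ye _; lra.
    have := fnormD (y - z) (z - p.1); rewrite addrA subrK => /le_trans; apply.
    by rewrite /= in zp; lra.
have [f fP] := choice (fun np : nat * (X * R) => step np.1 np.2).
have /fspace_nbhsP[e0 e0_gt0 e0O] : nbhs x0 O.
  by have := oO; rewrite openE; exact.
pose s := fix s n := if n is k.+1 then f (k, s k) else (x0, e0 / 2).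
have s0 n : 0 < (s n).2.
  elim: n => [|n IH] /=; first by rewrite divr_gt0.
  by have [] := fP (n, s n) IH.
have sS n y : N (y - (s n.+1).1) <= (s n.+1).2 -> N (y - (s n).1) <= (s n).2.
  by have [_ _ /(_ y) sy] := fP (n, s n) (s0 n) => /sy[].
have sA n y : N (y - (s n.+1).1) <= (s n.+1).2 -> A n y.
  by have [_ _ /(_ y) sy] := fP (n, s n) (s0 n) => /sy[].
have sD n k y : N (y - (s (n + k)%N).1) <= (s (n + k)%N).2 ->
    N (y - (s n).1) <= (s n).2.
  by elim: k => [|k IH]; rewrite ?addn0// addnS => /sS.
have sm n m : (n <= m)%N -> N ((s m).1 - (s n).1) <= (s n).2.
  by move=> nm; apply: (@sD n (m - n)%N); rewrite subnKC// subrr fnorm0 ltW.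
(* Halving gives geometric decay; this weaker 1 / n bound already makes the radii tend to 0 by the
   Archimedean property. *)
have shalf n : (s n).2 * n.+1%:R <= e0 / 2.
  elim: n => [|n IH]; first by rewrite mulr1.
  have [_ /= h _] := fP (n, s n) (s0 n).
  apply: le_trans IH; apply: (le_trans (_ : _ <= (s n).2 / 2 * n.+2%:R)).
    by rewrite ler_wpM2r.
  have := s0 n; rewrite -(natr1 n.+1); have : 1 <= n.+1%:R :> R by rewrite ler1n.
  nra.
have small e : 0 < e -> exists n, (s n).2 < e.
  move=> epos; exists (Num.bound (e0 / 2 / e)).
  have := archi_boundP (ltW (divr_gt0 (divr_gt0 e0_gt0 (ltr0Sn _ 1)) epos)).
  set n := Num.bound _; rewrite ltr_pdivrMr// => ne.
  have := le_lt_trans (shalf n) ne; rewrite -natr1 => sn.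
  have := s0 n; have : 0 <= n%:R :> R by []; nra.
have [|l sl] := fspace_metric_complete dX (u := fun n => (s n).1).
  move=> e epos; have [k ke] := small (e / 2) (divr_gt0 epos (ltr0Sn _ 1)).
  exists k => m n km kn; rewrite delta_fnorm.
  rewrite (_ : _ - _ = ((s m).1 - (s k).1) - ((s n).1 - (s k).1)); last first.
    by rewrite opprB addrA subrK.
  apply: le_lt_trans (fnormD _ _) _; rewrite fnormN.
  by have := sm _ _ km; have := sm _ _ kn; lra.
have lP n : N (l - (s n).1) <= (s n).2.
  apply/ler_addgt0Pr => e epos.
  have [k _ /= kl] : \forall k \near \oo, N ((s k).1 - l) < e.
    apply: (sl [set y | N (y - l) < e]).
    by apply/fspace_nbhsP; exists e.
  have := kl (maxn k n) (leq_maxl _ _); have := sm n (maxn k n) (leq_maxr _ _).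
  have := fnormD (l - (s (maxn k n)).1) ((s (maxn k n)).1 - (s n).1).
  rewrite addrA subrK -(fnormN (l - _)) opprB.
  by lra.
exists l; split; last by move=> n _; exact: sA (lP n.+1).
by apply: e0O; apply: le_lt_trans (lP 0%N) _; rewrite /=; lra.
Qed.

End fspaces.

(** * Roots and sums along multiples *)

(** Passes from the root-free inequalities of schedules to the distance conditions on [T] and
    [S]. *)
Lemma le_root (R : realType) (d : nat) (a E k n : R) :
  (0 < d)%N -> 0 <= a -> 0 <= E -> 0 <= k -> 0 < n ->
  a ^+ d * n <= E ^+ d * k -> a <= E * (k `^ d%:R^-1 / n `^ d%:R^-1).
Proof.
move=> d0 a0 E0 k0 n0 an.
have rootK (x : R) : 0 <= x -> (x `^ d%:R^-1) ^+ d = x.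
  move=> x0; rewrite -powR_mulrn ?powR_ge0// -powRrM mulVf ?powRr1//.
  by rewrite pnatr_eq0 -lt0n.
have q0 : 0 <= k `^ d%:R^-1 / n `^ d%:R^-1 by rewrite divr_ge0 ?powR_ge0.
rewrite -(ler_pXn2r d0) ?nnegrE//; last exact: mulr_ge0.
by rewrite exprMn expr_div_n !rootK ?(ltW n0)// mulrA ler_pdivlMr.
Qed.

(* Since f 0 = 0 and subtraction is truncated, the summand is f |t - t0|. *)
Lemma sum_abs_diff (R : realType) (f : nat -> R) (t0 e : nat) :
  (t0 < e)%N -> f 0%N = 0 -> (forall k, 0 <= f k) ->
  \sum_(t < e) (f (t0 - t)%N + f (t - t0)%N) <= 2 * \sum_(k < e) f k.
Proof.
move=> t0e f0 fge0; rewrite big_split mulr_natl mulr2n lerD//=.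
  have mono m n : (m <= n)%N -> \sum_(k < m) f k <= \sum_(k < n) f k.
    by move=> mn; rewrite -(subnKC mn) big_split_ord/= lerDl sumr_ge0.
  apply: le_trans (mono _ _ t0e); elim: t0 e {t0e} => [|t0 IH] [|e].
  - by rewrite big_ord0 sumr_ge0.
  - by rewrite big1 ?sumr_ge0.
  - by rewrite big_ord0 sumr_ge0.
  rewrite big_ord_recl subn0 [leRHS]big_ord_recr/= addrC lerD2r.
  by apply: le_trans (IH e); apply: ler_sum => i _; rewrite /bump add1n subSS.
elim: t0 e {t0e} => [|t0 IH] [|e]; rewrite ?big_ord0//.
  by apply: ler_sum => i _; rewrite subn0.
rewrite big_ord_recl f0 add0r [leRHS]big_ord_recr/= ler_wpDr//.
Qed.

(** The positive multiples of N are distinct indices >= N, so their sum is bounded by a tail of the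
    series. *)
Lemma sparse_tail (R : realType) (c : R^nat) (e : R) :
  (forall k, 0 <= c k) -> cvgn (series c) -> 0 < e ->
  exists N0, forall N, (N0 <= N)%N -> forall n,
    \sum_(k < n) (if k == 0%N :> nat then 0 else c (N * k)%N) < e.
Proof.
move=> c0 /cvg_cauchy/cauchy_seriesP cc e0.
have [[P Q] [[N1 _ N1P] [N2 _ N2Q]] PQ] := cc _ e0.
(* The 1 forces N > 0, without which the multiples would coincide. *)
exists (maxn 1 (maxn N1 N2)) => N; rewrite !geq_max => /and3P[N0 N1N N2N] n.
apply: (@le_lt_trans _ _ (\sum_(N <= k < N * n) c k)); last first.
  have [Nn|nN] := leqP N (N * n)%N; last by rewrite big_geq// ltnW.
  apply: le_lt_trans (PQ (N, (N * n)%N) _); first exact: ler_norm.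
  by split; [exact: N1P|apply: N2Q; exact: leq_trans Nn].
case: n => [|n]; first by rewrite big_ord0 sumr_ge0.
elim: n => [|n IH]; first by rewrite big_ord_recr big_ord0/= addr0 sumr_ge0.
rewrite big_ord_recr/= (@big_cat_nat _ _ _ (N * n.+1))//=.
- rewrite lerD// big_ltn; first by rewrite lerDl sumr_ge0.
  by rewrite ltn_pmul2l.
- by rewrite leq_pmulr.
- by rewrite leq_pmul2l.
Qed.

(** * Approximation by vectors whose orbits hit a target *)

Section hitting_sets.
Context (R : realType) (K : numFieldType) (X : topologicalLmodType K).
Context (delta : X -> X -> R) (d : nat) (Q : set 'rV[R]_d).
Context (T : nat -> 'rV[R]_d -> {linear X -> X}) (S : nat -> 'rV[R]_d -> X -> X).
Hypothesis dX : fspace_metric delta.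
Local Notation N := (fnorm delta).

(** Condition (1) for one vector and one parameter set; [locally_stable] is condition (2)
    likewise. *)
Definition summably_decoupled (D : R) (u : X) : Prop :=
  exists (kappa : nat) (c : R^nat),
  [/\ (0 < kappa)%N, forall k, 0 < c k, cvgn (series c) &
      forall (n k : nat) (lambda mu : 'rV[R]_d),
        (kappa <= k)%N -> Q lambda -> Q mu ->
        `|lambda - mu| <= D * (k%:R `^ d%:R^-1 / (n + k)%:R `^ d%:R^-1) ->
        N (T (n + k)%N lambda (S n mu u)) <= c k /\
        N (T n lambda (S (n + k)%N mu u)) <= c k].

Definition locally_stable (u : X) : Prop :=
  forall eta : R, 0 < eta -> exists2 tau : R, 0 < tau &
  forall (n : nat) (lambda mu : 'rV[R]_d), (0 < n)%N -> Q lambda -> Q mu ->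
    `|lambda - mu| <= tau / n%:R `^ d%:R^-1 ->
    N (T n lambda (S n mu u) - u) < eta.

(** With [Q] in a countable cover of Lambda, [v] in a countable dense set and e = 1 / (k + 1), these
    sets intersect in the common universal vectors. *)
Definition hitting (v : X) (e : R) : set X :=
  [set w | forall lambda, Q lambda ->
    exists2 n, (0 < n)%N & N (T n lambda w - v) < e].

(** Take n = 0 and mu = lambda, where the distance condition is trivial. *)
Lemma summably_decoupled0 (D : R) (u : X) :
  (0 < d)%N -> 0 <= D ->
  (forall lambda x, Q lambda -> T 0%N lambda x = x) ->
  (forall lambda, Q lambda -> S 0%N lambda u = u) ->
  summably_decoupled D u ->
  exists (kappa : nat) (c : R^nat), [/\ (0 < kappa)%N, forall k, 0 < c k,
    cvgn (series c) & forall k lambda, (kappa <= k)%N -> Q lambda ->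
      N (T k lambda u) <= c k /\ N (S k lambda u) <= c k].
Proof.
move=> d0 D0 T0 S0 [kappa [c [k0 c0 cc H]]]; exists kappa, c; split => //.
move=> k lambda kk Ql; have := H 0%N k lambda lambda kk Ql Ql.
rewrite S0// T0// !add0n; apply; rewrite subrr normr0 mulr_ge0//.
by rewrite divr_ge0// powR_ge0.
Qed.

(** A time t of the schedule becomes the index M * t. This scaling preserves the ratios k / (n + k)
    in the distance conditions and makes all index gaps at least M, where the sums of the bounds are
    small. *)
Lemma hitting_approx (D : R) (c : 'rV[R]_d) (h : R) (u v : X) (e : R) :
  (0 < d)%N -> 0 < D -> 0 < h ->
  2 ^+ d.+1 / (D / 2) ^+ d * (2 * h) ^+ d <= 4^-1 ->
  (forall x, Q x -> `|x - c| <= h) ->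
  (forall lambda x, Q lambda -> T 0%N lambda x = x) ->
  (forall lambda, Q lambda -> S 0%N lambda u = u) ->
  (forall lambda, Q lambda -> S 0%N lambda v = v) ->
  summably_decoupled D u -> summably_decoupled D v -> locally_stable v ->
  0 < e ->
  exists2 w, N (w - u) < e & hitting v e w.
Proof.
move=> d0 D0 h0 hsmall Qh T0 S0u S0v decu decv stabv e0.
have e4 : 0 < e / 4 by rewrite divr_gt0.
have [ku [cu [ku0 cu0 ccu Hu]]] := summably_decoupled0 d0 (ltW D0) T0 S0u decu.
have [kv [cv [kv0 cv0 ccv Hv]]] := decv.
have [kv' [cv' [kv'0 cv'0 ccv' Hv']]] :=
  summably_decoupled0 d0 (ltW D0) T0 S0v decv.
have [tau tau0 Htau] := stabv _ e4.
have [Nu NuP] := sparse_tail (fun k => ltW (cu0 k)) ccu e4.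
have [Nv NvP] := sparse_tail (fun k => ltW (cv0 k)) ccv e4.
have [Nv' Nv'P] := sparse_tail (fun k => ltW (cv'0 k)) ccv' e4.
(* Half of [D] for each leg of the path from lambda through pt t0 to pt t. *)
set kap := (D / 2) ^+ d in hsmall.
have kap0 : 0 < kap by rewrite exprn_gt0// divr_gt0.
have [Nt NtP] : exists Nt : nat, 2 * tau ^+ d / kap < Nt%:R.
  exists (Num.bound (2 * tau ^+ d / kap)); rewrite archi_boundP//.
  by rewrite divr_ge0 ?(ltW kap0)// mulr_ge0// exprn_ge0// ltW.
pose M := (\max_(i <- [:: ku; kv; kv'; Nu; Nv; Nv'; Nt]) i)%N.
have MP i : i \in [:: ku; kv; kv'; Nu; Nv; Nv'; Nt] -> (i <= M)%N.
  by move=> ?; exact: (@leq_bigmax_seq _ _ predT id).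
have Mku : (ku <= M)%N by apply: MP; rewrite !inE eqxx ?orbT.
have Mkv : (kv <= M)%N by apply: MP; rewrite !inE eqxx ?orbT.
have Mkv' : (kv' <= M)%N by apply: MP; rewrite !inE eqxx ?orbT.
have MNu : (Nu <= M)%N by apply: MP; rewrite !inE eqxx ?orbT.
have MNv : (Nv <= M)%N by apply: MP; rewrite !inE eqxx ?orbT.
have MNv' : (Nv' <= M)%N by apply: MP; rewrite !inE eqxx ?orbT.
have MNt : (Nt <= M)%N by apply: MP; rewrite !inE eqxx ?orbT.
clearbody M; clear MP.
have M0 : (0 < M)%N by exact: leq_trans Mku.
have MR : 0 < M%:R :> R by rewrite ltr0n.
(* Being served at t0 then means |lambda - pt t0| <= tau / (M * t0)^(1/d), the premise of stability
   at index M * t0. The bound M >= Nt gives theta <= kap / 2. *)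
pose theta := tau ^+ d / M%:R.
have taud : 0 < tau ^+ d by rewrite exprn_gt0.
have theta0 : 0 < theta by rewrite divr_gt0.
have thetak : theta <= kap / 2.
  rewrite ler_pdivrMr// mulrAC ler_pdivlMr// mulrC (mulrC kap) -ler_pdivrMr//.
  by apply: le_trans (ltW NtP) _; rewrite ler_nat.
have [m m0 [q [act [pt [actP cover sep]]]]] :=
  @schedule_ball R d theta kap Q theta0 kap0 c h d0 h0 hsmall.
have tail (cc : nat -> R) (k0 : R) n :
    (forall k, 0 <= cc k) -> (0 < n)%N -> (n < q)%N ->
    (forall i, \sum_(k < i) (if k == 0%N :> nat then 0 else cc (M * k)%N) < k0) ->
    cc (M * n)%N < k0.
  move=> cc0 n0 nq /(_ q); apply: le_lt_trans.
  rewrite (bigD1 (Ordinal nq))//= gtn_eqF// lerDl sumr_ge0// => i _.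
  by case: ifP.
pose term (t : nat) := S (M * t)%N (pt t) v.
exists (u + \sum_(t < q | act t) term t).
  rewrite addrAC subrr add0r.
  apply: le_lt_trans (fnorm_sum dX _ _ _) _; apply: lt_trans (_ : e / 4 < e);
    last by lra.
  apply: le_lt_trans (Nv'P M MNv' q); rewrite big_mkcond; apply: ler_sum => t _.
  case: ifP => at_; last by case: ifP => // _; exact: ltW.
  have [/andP[mt _] [Qt _]] := actP _ at_.
  have t0 : (0 < t)%N by exact: leq_trans mt.
  rewrite gtn_eqF//; apply: (Hv' _ _ _ Qt).2.
  by apply: leq_trans Mkv' _; rewrite leq_pmulr.
move=> lambda Ql; have [|t0 at0 lt0] := cover lambda.
  by split=> //; exact: Qh.
have [/andP[mt0 t0q] [Qt0 _]] := actP _ at0.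
have t00 : (0 < t0)%N by exact: leq_trans mt0.
have t0R : 1 <= t0%:R :> R by rewrite ler1n.
exists (M * t0)%N; first by rewrite muln_gt0 M0.
set n0 := (M * t0)%N.
pose rest := \sum_(t < q | act t && (t != Ordinal t0q)) T n0 lambda (term t).
(* The errors are below e/4 from [u], below e/4 from the term active at t0, and at most e/2 from all
   other terms. *)
have -> : T n0 lambda (u + \sum_(t < q | act t) term t) - v =
    T n0 lambda u + (T n0 lambda (term t0) - v) + rest.
  rewrite linearD linear_sum (bigD1 (Ordinal t0q))//=.
  by rewrite -!addrA; congr (_ + (_ + _)); rewrite addrC.
have b1 : N (T n0 lambda u) < e / 4.
  apply: (@le_lt_trans _ _ (cu n0)).
    by apply: (Hu _ _ _ Ql).1; apply: leq_trans Mku _; rewrite leq_pmulr.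
  by apply: (tail cu) => //; [move=> k; exact: ltW|exact: NuP].
have b2 : N (T n0 lambda (term t0) - v) < e / 4.
  apply: Htau => //; first by rewrite muln_gt0 M0.
  have -> : tau / n0%:R `^ d%:R^-1 = tau * (1 `^ d%:R^-1 / n0%:R `^ d%:R^-1).
    by rewrite powR1 div1r.
  apply: le_root => //; [exact: ltW|by rewrite ltr0n muln_gt0 M0|].
  rewrite /n0 natrM mulr1 mulrCA mulrC -ler_pdivlMr//.
have b3 : N rest <= 2 * (e / 4).
  pose f k := if k == 0%N :> nat then 0 else cv (M * k)%N.
  have f_ge0 k : 0 <= f k by rewrite /f; case: ifP => // _; exact: ltW.
  apply: (@le_trans _ _ (2 * \sum_(k < q) f k)); last first.
    by rewrite ler_pM2l//; exact: ltW (NvP M MNv q).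
  apply: le_trans (sum_abs_diff t0q _ f_ge0) => //.
  apply: le_trans (fnorm_sum dX _ _ _) _; rewrite big_mkcond.
  apply: ler_sum => t _; case: ifP => [/andP[at_ tt0]|_]; last exact: addr_ge0.
  have [/andP[mt tq] [Qt _]] := actP _ at_.
  have tR : 1 <= t%:R :> R by rewrite ler1n; exact: leq_trans mt.
  have MR' : 0 <= M%:R :> R by [].
  have near k n : (0 < n)%N -> (`|lambda - pt t0| ^+ d * n%:R <= kap * k%:R) ->
      (`|pt t0 - pt t| ^+ d * n%:R <= kap * k%:R) ->
      `|lambda - pt t| <=
        D * ((M * k)%:R `^ d%:R^-1 / (M * n)%:R `^ d%:R^-1).
    move=> npos l1 l2; have := ler_distD (pt t0) lambda (pt t).
    have D2 : 0 <= D / 2 by rewrite divr_ge0// ltW.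
    have Mn : 0 < (M * n)%:R :> R by rewrite ltr0n muln_gt0 M0.
    have s1 : `|lambda - pt t0| ^+ d * (M * n)%:R <= (D / 2) ^+ d * (M * k)%:R.
      by rewrite !natrM mulrCA (mulrCA _ M%:R) ler_pM2l.
    have s2 : `|pt t0 - pt t| ^+ d * (M * n)%:R <= (D / 2) ^+ d * (M * k)%:R.
      by rewrite !natrM mulrCA (mulrCA _ M%:R) ler_pM2l.
    have := le_root d0 (normr_ge0 _) D2 (ler0n _ _) Mn s1.
    have := le_root d0 (normr_ge0 _) D2 (ler0n _ _) Mn s2.
    set r := (_ / _ `^ _); set x := `| _ |; set y := `| _ |; set z := `| _ |.
    by lra.
  have [tlt|tgt|teq] := ltngtP t t0;
    last by rewrite -(inj_eq val_inj) /= teq eqxx in tt0.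
  (* Earlier terms fall under the first estimate, with n = M * t; later ones under the second, with
     n = M * t0. *)
  - have -> : (t - t0 = 0)%N by apply/eqP; rewrite subn_eq0 ltnW.
    rewrite [f 0%N]/f eqxx addr0 /f gtn_eqF ?subn_gt0//.
    have n0E : n0 = (M * t + M * (t0 - t))%N by rewrite -mulnDr subnKC// ltnW.
    rewrite n0E; apply: (Hv _ _ _ _ _ Ql Qt _).1.
      by apply: leq_trans Mkv _; rewrite leq_pmulr// subn_gt0.
    rewrite -mulnDr subnKC; last exact: ltnW.
    apply: near => //; last by rewrite distrC; exact: sep.
    apply: le_trans lt0 _; apply: le_trans thetak _; rewrite ler_pM2l//.
    have : 1 <= (t0 - t)%:R :> R by rewrite ler1n subn_gt0.
    by lra.
  - have -> : (t0 - t = 0)%N by apply/eqP; rewrite subn_eq0 ltnW.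
    rewrite [f 0%N]/f eqxx add0r /f gtn_eqF ?subn_gt0//.
    have tE : (M * t = n0 + M * (t - t0))%N by rewrite -mulnDr subnKC// ltnW.
    rewrite /term tE; apply: (Hv _ _ _ _ _ Ql Qt _).2.
      by apply: leq_trans Mkv _; rewrite leq_pmulr// subn_gt0.
    rewrite -tE; apply: near; [exact: leq_trans mt| |exact: sep].
    set P := _ ^+ d in lt0 *.
    have P0 : 0 <= P by rewrite exprn_ge0.
    have j1 : 1 <= (t - t0)%:R :> R by rewrite ler1n subn_gt0.
    have -> : t%:R = t0%:R + (t - t0)%:R :> R by rewrite -natrD subnKC// ltnW.
    (* Put j = t - t0. As t0 and j are at least 1, t <= t0 * (1 + j), so P * t <= kap / 2 * (1 + j)
       <= kap * j. *)
    apply: (@le_trans _ _ (P * t0%:R * (1 + (t - t0)%:R))).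
      rewrite -mulrA ler_wpM2l//; nra.
    apply: (@le_trans _ _ (kap / 2 * (1 + (t - t0)%:R))).
      by rewrite ler_wpM2r ?addr_ge0//; exact: le_trans thetak.
    by rewrite -mulrA ler_pM2l//; lra.
apply: le_lt_trans (fnormD dX _ _) _.
have := fnormD dX (T n0 lambda u) (T n0 lambda (term t0) - v).
by lra.
Qed.

End hitting_sets.

(** * Openness of the hitting sets and conclusion *)

(** By joint continuity, one n serves all parameters near lambda and all vectors near w; compactness
    of [Q] makes the neighbourhood of w uniform. *)
Lemma hitting_open (R : realType) (K : numFieldType)
    (X : topologicalLmodType K) (delta : X -> X -> R) (d : nat)
    (Lambda Q : set 'rV[R]_d) (T : nat -> 'rV[R]_d -> {linear X -> X})
    (v : X) (e : R) :
  fspace_metric delta -> continuous_operator_family Lambda T ->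
  compact Q -> Q `<=` Lambda -> open (hitting delta Q T v e).
Proof.
move=> dX cT cQ QL; rewrite openE => w wU.
(* The guard [Q lambda] is part of [P] because nearby parameters range over the whole space, whereas
   continuity holds only within Lambda. *)
pose P (w' : X) (lambda : 'rV[R]_d) := Q lambda ->
  exists2 n, (0 < n)%N & fnorm delta (T n lambda w' - v) < e.
have : \forall w' \near w, Q `<=` P w'.
  apply: ((compact_near_coveringP Q).1 cQ) => lambda Ql.
  have [n n0 ne] := wU _ Ql.
  have [_ /subspace_continuousP/(_ (lambda, w) (conj (QL _ Ql) I))] := cT n n0.
  move=> /(_ [set y | fnorm delta (y - v) < e]) [].
    apply/(fspace_nbhsP dX); exists (e - fnorm delta (T n lambda w - v)).
      by rewrite subr_gt0.
    move=> y; have := fnormD dX (y - T n lambda w) (T n lambda w - v).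
    by rewrite addrA subrK ltrBrDr /= => /le_lt_trans; apply.
  move=> [A B] /= [nA nB] AB; exists (A, B) => //= -[x y] [Ax By] Qx.
  by exists n => //; apply: (AB (x, y)) => //; split => //; exact: QL.
by apply: filterS => w' QP lambda Ql; exact: QP.
Qed.

(* Separability is necessary: on l^2(N, H) with H a non-separable Hilbert
   space, the powers of twice the backward shift satisfy all the other
   hypotheses, but no countable set is dense. *)
Theorem theorem1p4 (R : realType) (K : numFieldType)
    (X : topologicalLmodType K) (delta : X -> X -> R)
    (d : nat) (Lambda : set 'rV[R]_d)
    (T : nat -> 'rV[R]_d -> {linear X -> X})
    (calD : set X) (S : nat -> 'rV[R]_d -> X -> X) (D : R) :
  real_or_complex R K ->
  fspace_metric delta ->
  separable X ->
  (0 < d)%N ->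
  sigma_compact Lambda ->
  continuous_operator_family Lambda T ->
  (forall lambda u, Lambda lambda -> T 0%N lambda u = u) ->
  dense calD ->
  (forall n lambda u, (0 < n)%N -> Lambda lambda -> calD u ->
    calD (S n lambda u)) ->
  (forall lambda u, Lambda lambda -> calD u -> S 0%N lambda u = u) ->
  (forall n lambda u, (0 < n)%N -> Lambda lambda -> calD u ->
    T n lambda (S n lambda u) = u) ->
  0 < D ->
  (forall (u : X) (Q : set 'rV[R]_d),
    calD u -> compact Q -> Q `<=` Lambda ->
    (exists (kappa : nat) (c : R^nat),
      [/\ (0 < kappa)%N,
          forall k, 0 < c k,
          cvgn (series c) &
          forall (n k : nat) (lambda mu : 'rV[R]_d),
            (kappa <= k)%N -> Q lambda -> Q mu ->
            `|lambda - mu| <=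
              D * (k%:R `^ d%:R^-1 / (n + k)%:R `^ d%:R^-1) ->
            fnorm delta (T (n + k)%N lambda (S n mu u)) <= c k /\
            fnorm delta (T n lambda (S (n + k)%N mu u)) <= c k]) /\
    (forall eta : R, 0 < eta -> exists2 tau : R, 0 < tau &
      forall (n : nat) (lambda mu : 'rV[R]_d),
        (0 < n)%N -> Q lambda -> Q mu ->
        `|lambda - mu| <= tau / n%:R `^ d%:R^-1 ->
        fnorm delta (T n lambda (S n mu u) - u) < eta)) ->
  dense (common_universal Lambda T) /\ Gdelta (common_universal Lambda T).
Proof.
move=> _ dX [Den cDen dDen] d0 [F cF LE] cT T0 dD SD S0 _ D0 H.
have [h h0 hsmall] : exists2 h : R, 0 < h &
    2 ^+ d.+1 / (D / 2) ^+ d * (2 * h) ^+ d <= 4^-1.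
  have B0 : 0 < 2 ^+ d.+1 / (D / 2) ^+ d.
    by rewrite divr_gt0 ?exprn_gt0// divr_gt0.
  (* Since x <= 1 gives x ^ d <= x, bounding x by 4^-1 / B suffices. *)
  set B := (X in 0 < X) in B0 *; pose x := Num.min 1 (4^-1 / B).
  have x0 : 0 < x by rewrite lt_min ltr01 divr_gt0 ?invr_gt0.
  have x1 : x <= 1 by rewrite ge_min lexx.
  exists (x / 2); first by rewrite divr_gt0.
  rewrite (_ : 2 * (x / 2) = x); last by field.
  rewrite mulrC -ler_pdivlMr//.
  apply: (@le_trans _ _ x); last by rewrite ge_min lexx orbT.
  by case: (d) d0 => // d' _; rewrite exprS ler_piMr ?exprn_ile1// ltW.
have [f fI] := countable_injP _ cDen.
(* Enumerates [Den], with default 0 off the image of [f]. The default is harmless: [dU] holds for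
   any target. *)
pose vec j := xget 0 [set v | Den v /\ f v = j].
pose piece i (a : 'rV[int]_d) := F i `&`
  closed_ball_ Num.norm (\row_k (h * (a 0 k)%:~R)) h.
have cpiece i a : compact (piece i a).
  by apply: compact_closedI; [exact: cF|exact: closed_closed_ball_].
have pieceL i a : piece i a `<=` Lambda.
  by move=> x [Fx _]; rewrite LE; exists i.
pose U (p : nat * 'rV[int]_d * nat * nat) :=
  hitting delta (piece p.1.1.1 p.1.1.2) T (vec p.1.2) (p.2.+1%:R^-1).
(* Numbers coding no index contribute the neutral [setT]. *)
pose A n := if unpickle n is Some p then U p else setT.
have oU p : open (U p) by exact: (hitting_open (Lambda := Lambda)).
have dU p : dense (U p).
  case: p => [[[i a] j] k]; rewrite /U/=; set Q := piece i a; set v0 := vec j.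
  set e := k.+1%:R^-1; have e0 : 0 < e :> R by rewrite invr_gt0.
  move=> O [x Ox] oO.
  have [u [Ou Du]] := dD O (ex_intro _ x Ox) oO.
  have /(fspace_nbhsP dX)[r r0 rO] : nbhs u O.
    by have := oO; rewrite openE; exact.
  have e2 : 0 < e / 2 by rewrite divr_gt0.
  (* The target v0 need not lie in calD, so a nearby v of calD is hit instead, within e / 2. *)
  have [v Dv v0v] : exists2 v, calD v & fnorm delta (v - v0) < e / 2.
    apply: (dense_nbhs (x := v0) dD); apply/(fspace_nbhsP dX).
    by exists (e / 2).
  have [decu _] := H u Q Du (cpiece i a) (pieceL i a).
  have [decv stabv] := H v Q Dv (cpiece i a) (pieceL i a).
  have QL l : Q l -> Lambda l by exact: pieceL.
  have [|||||w wu hw] := @hitting_approx _ _ _ delta d Q T S dX D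
    (\row_k (h * (a 0 k)%:~R)) h u v (Num.min r (e / 2)) d0 D0 h0 hsmall
    _ _ _ _ decu decv stabv.
  - by move=> y [_]; rewrite /closed_ball_/= distrC.
  - by move=> l y /QL; exact: T0.
  - by move=> l /QL Ll; exact: S0.
  - by move=> l /QL Ll; exact: S0.
  - by rewrite lt_min r0.
  exists w; split.
    by apply: rO; apply: lt_le_trans wu _; rewrite ge_min lexx.
  move=> l /hw[n n0]; rewrite lt_min => /andP[_ nv]; exists n => //.
  have := fnormD dX (T n l w - v) (v - v0); rewrite addrA subrK.
  by lra.
have oA n : open (A n).
  by rewrite /A; case: unpickle => [p|]; [exact: oU|exact: openT].
have dA n : dense (A n).
  rewrite /A; case: unpickle => [p|]; first exact: dU.
  by move=> O [x Ox] _; exists x.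
suff -> : common_universal Lambda T = \bigcap_n A n.
  by split; [exact: (fspace_baire dX)|exists A].
apply/seteqP; split=> u.
  move=> uU n _; rewrite /A; case: unpickle => // -[[[i a] j] k] l /pieceL Ll /=.
  have [|_ [n' n'0 <-] h'] := dense_nbhs (x := vec j)
    (B := [set y | fnorm delta (y - vec j) < k.+1%:R^-1]) (uU l Ll) _.
    by apply/(fspace_nbhsP dX); exists (k.+1%:R^-1); rewrite ?invr_gt0.
  by exists n'.
move=> uA l Ll O [x Ox] oO.
have [v [Ov Dv]] := dDen O (ex_intro _ x Ox) oO.
have /(fspace_nbhsP dX)[r r0 rO] : nbhs v O.
  by have := oO; rewrite openE; exact.
move: (Ll); rewrite LE => -[i _ Fl].
(* Rounding down to the grid of step h moves each coordinate by less than h. *)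
pose a : 'rV[int]_d := \row_k Num.floor (l 0 k / h).
have la : piece i a l.
  split => //; rewrite /closed_ball_/= distrC row_norm_le ?(ltW h0)//.
  apply/forallP => k; rewrite !mxE.
  have /andP[] := floor_itv (l 0 k / h).
  rewrite ler_pdivlMr// ltr_pdivrMr// intrD mulrDl mul1r mulrC => lo hi.
  by rewrite ger0_norm; lra.
have vE : vec (f v) = v.
  have [|Dy fy] := @xgetPex _ 0 [set y | Den y /\ f y = f v]; first by exists v.
  by apply: fI => //; rewrite inE.
pose k := Num.bound r^-1.
have kr : k.+1%:R^-1 <= r.
  rewrite -[leRHS]invrK lef_pV2 ?posrE ?invr_gt0//.
  have /archi_boundP/ltW/le_trans : 0 <= r^-1 by rewrite invr_ge0 ltW.
  by apply; rewrite ler_nat.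
have := uA (pickle (i, a, f v, k)) I; rewrite /A pickleK => /(_ l la) /=[n n0].
rewrite vE => nv; exists (T n l u); split; last by exists n.
by apply: rO; exact: lt_le_trans kr.
Qed.
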